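(* Let $X$ be a topological space and let $\mathcal{F}$ be a sheaf of rings on $X$. Then $M:=\bigsqcup_{U\in\mathrm{Open}(X)}\mathcal{F}(U)$ is a common meadow with the operations defined, for $s\in\mathcal{F}(U)$ and $t\in\mathcal{F}(V)$ with $U,V$ open subsets of $X$, by $$s+t:=\rho_{U\cap V,U}(s)+\rho_{U\cap V,V}(t),\qquad s\cdot t:=\rho_{U\cap V,U}(s)\cdot\rho_{U\cap V,V}(t),$$ where the operations on the right are those of the ring $\mathcal{F}(U\cap V)$.
   Context: All rings are commutative with unit. $\mathrm{Open}(X)$ is the lattice of open subsets of $X$ ordered by inclusion. For a presheaf of rings $\mathcal{F}$ on $X$ and open sets $V\subseteq U$, $\rho_{V,U}:\mathcal{F}(U)\to\mathcal{F}(V)$ denotes the restriction map; it is required that $\mathcal{F}(\emptyset)=0$, the zero ring. A sheaf is a presheaf satisfying the usual locality and glueing conditions for every open cover of every open set. In $M$ the element $0$ is the zero of $\mathcal{F}(X)$, $1$ is the unit of $\mathcal{F}(X)$, the unary operation $-$ is the negation in each ring $\mathcal{F}(U)$, and $\mathbf{a}$ is the unique element of $\mathcal{F}(\emptyset)$. A pre-meadow is a set $P$ with two distinct elements $0,1$, binary operations $+,\cdot$ and a unary operation $-$ satisfying: $(P_1)$ $(x+y)+z=x+(y+z)$; $(P_2)$ $x+y=y+x$; $(P_3)$ $x+0=x$; $(P_4)$ $x+(-x)=0\cdot x$; $(P_5)$ $(x\cdot y)\cdot z=x\cdot(y\cdot z)$; $(P_6)$ $x\cdot y=y\cdot x$;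 $(P_7)$ $1\cdot x=x$; $(P_8)$ $x\cdot(y+z)=x\cdot y+x\cdot z$; $(P_9)$ $-(-x)=x$; $(P_{10})$ $0\cdot(x+y)=0\cdot x\cdot y$. For $z\in 0\cdot P=\{0\cdot x\mid x\in P\}$ put $P_z=\{x\in P\mid 0\cdot x=z\}$. A pre-meadow with $\mathbf{a}$ is a pre-meadow $P$ for which there exists a unique element of $0\cdot P$, denoted $\mathbf{a}$, such that $|P_{\mathbf{a}}|=1$ and $x+\mathbf{a}=\mathbf{a}$ for all $x\in P$. A common meadow is a pre-meadow with $\mathbf{a}$ equipped with an inverse function $(\cdot)^{-1}$ satisfying: $(M_1)$ $x\cdot x^{-1}=1+0\cdot x^{-1}$; $(M_2)$ $(x\cdot y)^{-1}=x^{-1}\cdot y^{-1}$; $(M_3)$ $(1+0\cdot x)^{-1}=1+0\cdot x$; $(M_4)$ $0^{-1}=\mathbf{a}$.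
   Formalization: Two hypotheses are added, without which the claim is false: X is non-empty (otherwise 0 = 1 in M), and F(U) is not the zero ring for every non-empty open U (otherwise M2, M3 and M4 force the element of F(U) to equal a). *)

(* Defs.v *)
From HB Require Import structures.
From mathcomp Require Import all_boot all_order all_algebra.
From mathcomp Require Import boolp classical_sets functions cardinality topology.
Set Implicit Arguments.
Unset Strict Implicit.
Unset Printing Implicit Defensive.
Import GRing.Theory.
Local Open Scope classical_set_scope.
Local Open Scope card_scope.
Local Open Scope ring_scope.

Record opens (X : topologicalType) := Opens {
  opens_set :> set X;
  opens_open : open opens_set }.

Definition opens0 (X : topologicalType) : opens X := Opens (@open0 X).

Definition opensT (X : topologicalType) : opens X := Opens (@openT X).

Definition opensI (X : topologicalType) (U V : opens X) : opens X :=
  Opens (openI (opens_open U) (opens_open V)).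

Lemma opensIl (X : topologicalType) (U V : opens X) : opensI U V `<=` U.
Proof. exact: subIsetl. Qed.

Lemma opensIr (X : topologicalType) (U V : opens X) : opensI U V `<=` V.
Proof. exact: subIsetr. Qed.

(* Sections form a [comPzRingType], so that zero rings are allowed.
   [res VU], for [VU : V `<=` U], is the restriction map usually written
   rho_{V,U}. *)
Record presheaf (X : topologicalType) := Presheaf {
  sect :> opens X -> comPzRingType;
  res : forall U V : opens X, V `<=` U -> {rmorphism sect U -> sect V};
  res_id : forall (U : opens X) (UU : U `<=` U) (s : sect U), res UU s = s;
  res_comp : forall (U V W : opens X) (VU : V `<=` U) (WV : W `<=` V)
    (WU : W `<=` U) (s : sect U), res WV (res VU s) = res WU s;
  sect_opens0 : forall s : sect (opens0 X), s = 0 }.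

Arguments res {X} p {U V} _.

Definition locality (X : topologicalType) (F : presheaf X) : Prop :=
  forall (U : opens X) (I : Type) (V : I -> opens X)
         (VU : forall i, V i `<=` U),
    U `<=` \bigcup_i V i ->
    forall s t : F U, (forall i, res F (VU i) s = res F (VU i) t) -> s = t.

Definition glueing (X : topologicalType) (F : presheaf X) : Prop :=
  forall (U : opens X) (I : Type) (V : I -> opens X)
         (VU : forall i, V i `<=` U),
    U `<=` \bigcup_i V i ->
    forall s : forall i, F (V i),
      (forall i j, res F (@opensIl X (V i) (V j)) (s i)
                 = res F (@opensIr X (V i) (V j)) (s j)) ->
      exists t : F U, forall i, res F (VU i) t = s i.

Definition is_sheaf (X : topologicalType) (F : presheaf X) : Prop :=
  locality F /\ glueing F.

Record meadow_ops (P : Type) := MeadowOps {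
  mzero : P;
  mone : P;
  madd : P -> P -> P;
  mmul : P -> P -> P;
  mopp : P -> P }.

Record is_premeadow (P : Type) (m : meadow_ops P) : Prop := IsPremeadow {
  premeadow_neq01 : mzero m <> mone m;
  premeadow_P1 : forall x y z,
    madd m (madd m x y) z = madd m x (madd m y z);
  premeadow_P2 : forall x y, madd m x y = madd m y x;
  premeadow_P3 : forall x, madd m x (mzero m) = x;
  premeadow_P4 : forall x, madd m x (mopp m x) = mmul m (mzero m) x;
  premeadow_P5 : forall x y z,
    mmul m (mmul m x y) z = mmul m x (mmul m y z);
  premeadow_P6 : forall x y, mmul m x y = mmul m y x;
  premeadow_P7 : forall x, mmul m (mone m) x = x;
  premeadow_P8 : forall x y z,
    mmul m x (madd m y z) = madd m (mmul m x y) (mmul m x z);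
  premeadow_P9 : forall x, mopp m (mopp m x) = x;
  premeadow_P10 : forall x y,
    mmul m (mzero m) (madd m x y) = mmul m (mmul m (mzero m) x) y }.

Definition zero_mul_set (P : Type) (m : meadow_ops P) : set P :=
  [set mmul m (mzero m) x | x in [set: P]].

Definition premeadow_fiber (P : Type) (m : meadow_ops P) (z : P) : set P :=
  [set x | mmul m (mzero m) x = z].

Definition is_premeadow_with_a (P : Type) (m : meadow_ops P) (a : P) : Prop :=
  is_premeadow m /\
  unique (fun z => [/\ zero_mul_set m z, premeadow_fiber m z #= `I_1
                     & forall x, madd m x z = z]) a.

Record is_common_meadow (P : Type) (m : meadow_ops P) (a : P) (inv : P -> P) :
    Prop := IsCommonMeadow {
  common_meadow_premeadow : is_premeadow_with_a m a;
  common_meadow_M1 : forall x,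
    mmul m x (inv x) = madd m (mone m) (mmul m (mzero m) (inv x));
  common_meadow_M2 : forall x y, inv (mmul m x y) = mmul m (inv x) (inv y);
  common_meadow_M3 : forall x,
    inv (madd m (mone m) (mmul m (mzero m) x))
    = madd m (mone m) (mmul m (mzero m) x);
  common_meadow_M4 : inv (mzero m) = a }.

Section SectionsMeadow.
Variables (X : topologicalType) (F : presheaf X).

Definition sections : Type := {U : opens X & F U}.

Definition section_of (U : opens X) (s : F U) : sections :=
  existT (fun U => F U : Type) U s.

Definition sections_add (s t : sections) : sections :=
  section_of (res F (@opensIl X (projT1 s) (projT1 t)) (projT2 s)
            + res F (@opensIr X (projT1 s) (projT1 t)) (projT2 t)).

Definition sections_mul (s t : sections) : sections :=
  section_of (res F (@opensIl X (projT1 s) (projT1 t)) (projT2 s)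
            * res F (@opensIr X (projT1 s) (projT1 t)) (projT2 t)).

Definition sections_opp (s : sections) : sections :=
  section_of (- projT2 s).

Definition sections_ops : meadow_ops sections :=
  MeadowOps (section_of (0 : F (opensT X))) (section_of (1 : F (opensT X)))
    sections_add sections_mul sections_opp.

Definition sections_a : sections := section_of (0 : F (opens0 X)).

End SectionsMeadow.

(* Main.v *)
Require Import Defs.
From HB Require Import structures.
From mathcomp Require Import all_boot all_order all_algebra.
From mathcomp Require Import boolp classical_sets functions cardinality topology.
Set Implicit Arguments.
Unset Strict Implicit.
Unset Printing Implicit Defensive.
Import GRing.Theory.
Local Open Scope classical_set_scope.
Local Open Scope ring_scope.

(** The inverse of a section [s] over [U] lives on the largest open [D] of [U]
    on which [s] becomes invertible.  Inverses in a commutative ring are unique,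
    so the local inverses agree on overlaps and glue to a section over [D], and
    locality shows that the glued section is an inverse of [s] there.  A pair
    (open set, inverse) that is maximal in this sense is unique, so that the
    meadow axioms M2-M4 reduce to exhibiting maximal inverses of [x * y],
    [1 + 0 * x] and [0]. *)

Lemma opens_inj (X : topologicalType) (U V : opens X) :
  U `<=` V -> V `<=` U -> U = V.
Proof.
case: U V => [U oU] [V oV] /= UV VU.
have E : U = V by apply/seteqP.
by case: _ / E oV {UV VU} => oV; rewrite (Prop_irrelevance oU oV).
Qed.

Lemma inv_uniq (R : comPzRingType) (x y z : R) : x * y = 1 -> x * z = 1 -> y = z.
Proof. by move=> xy xz; rewrite -[y]mulr1 -xz mulrA [y * x]mulrC xy mul1r. Qed.

Section Sections.
Variables (X : topologicalType) (F : presheaf X).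
Implicit Types (U V W : opens X) (x y z : sections F).

Lemma res_irr U V (VU VU' : V `<=` U) (s : F U) : res F VU s = res F VU' s.
Proof. by rewrite (Prop_irrelevance VU VU'). Qed.

Lemma res_trans U V W (VU : V `<=` U) (WV : W `<=` V) (s : F U) :
  res F WV (res F VU s) = res F (subset_trans WV VU) s.
Proof. exact: res_comp. Qed.

(** Restriction stands in for transport along [U = V]: once the two opens are identified, [res_id]
    makes it the identity. *)
Lemma section_eq U V (s : F U) (t : F V) (VU : V `<=` U) :
  U `<=` V -> res F VU s = t -> section_of s = section_of t.
Proof.
move=> UV <-; have E := opens_inj UV VU.
by case: _ / E VU {UV} => VU; rewrite res_id.
Qed.

Lemma sections_eq x y (yx : projT1 y `<=` projT1 x) :
  projT1 x `<=` projT1 y -> res F yx (projT2 x) = projT2 y -> x = y.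
Proof. by case: x y yx => [U s] [V t]; exact: section_eq. Qed.

Lemma eq_sections x y (yx : projT1 y `<=` projT1 x) :
  x = y -> res F yx (projT2 x) = projT2 y.
Proof. by move=> E; case: _ / E yx => yx; rewrite res_id. Qed.

Ltac open_sub := rewrite /= /setI /setT /set0 /=; move=> ? /=; tauto.

(** Splits an identity in the disjoint union into two inclusions of domains, which are
    propositional, and a ring identity over one open set, where matching restrictions may still
    differ in their inclusion proofs. *)
Ltac sections_ext :=
  unshelve eapply sections_eq; [open_sub | open_sub |
    rewrite /= !(rmorphD, rmorphM, rmorphN, rmorph0, rmorph1) /= ?res_trans].

Lemma sections_premeadow (X_nonempty : [set: X] !=set0)
    (F_nonzero : forall U, U !=set0 -> (1 : F U) <> 0) :
  is_premeadow (sections_ops F).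
Proof.
split=> /=.
- move=> E; apply: (F_nonzero (opensT X) X_nonempty).
  by have /= <- := @eq_sections (section_of 0) (section_of 1) (fun p => id) E; rewrite rmorph0.
- move=> [U s] [V t] [W r]; sections_ext.
  rewrite addrA; congr (_ + _ + _); exact: res_irr.
- move=> [U s] [V t]; sections_ext.
  rewrite addrC; congr (_ + _); exact: res_irr.
- move=> [U s]; sections_ext.
  by rewrite addr0 res_id.
- move=> [U s]; sections_ext.
  by rewrite mul0r; apply/eqP; rewrite subr_eq0; apply/eqP; exact: res_irr.
- move=> [U s] [V t] [W r]; sections_ext.
  rewrite mulrA; congr (_ * _ * _); exact: res_irr.
- move=> [U s] [V t]; sections_ext.
  rewrite mulrC; congr (_ * _); exact: res_irr.
- move=> [U s]; sections_ext.
  by rewrite mul1r res_id.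
- move=> [U s] [V t] [W r]; sections_ext.
  rewrite mulrDr; congr (_ * _ + _ * _); exact: res_irr.
- move=> [U s]; sections_ext.
  by rewrite opprK res_id.
- move=> [U s] [V t]; sections_ext.
  by rewrite !mul0r.
Qed.

Lemma sections_opens0 x : projT1 x `<=` set0 -> x = sections_a F.
Proof.
move=> x0; unshelve eapply sections_eq => //=.
by rewrite [LHS]sect_opens0.
Qed.

Lemma sections_premeadow_with_a (X_nonempty : [set: X] !=set0)
    (F_nonzero : forall U, U !=set0 -> (1 : F U) <> 0) :
  is_premeadow_with_a (sections_ops F) (sections_a F).
Proof.
have pre := sections_premeadow X_nonempty F_nonzero; split=> //.
have adda x : sections_add x (sections_a F) = sections_a F.
  by apply: sections_opens0; open_sub.
split=> [|z [_ _ addz]].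
  split=> //.
    by exists (sections_a F) => //; apply: sections_opens0; open_sub.
  suff -> : premeadow_fiber (sections_ops F) (sections_a F) = [set sections_a F].
    exact: card_set1.
  apply/seteqP; split=> x /=.
    (* Comparing domains suffices: [0 * x] lives over the domain of [x], which is therefore
       empty. *)
    move=> /(congr1 (fun y => projT1 y : set X)) /= x0.
    by apply: sections_opens0; rewrite -x0; open_sub.
  by move=> ->; apply: sections_opens0; open_sub.
(* Two absorbing elements coincide: [z = a + z = z + a = a]. *)
by rewrite -(addz (sections_a F)) (premeadow_P2 pre (sections_a F)) [RHS]adda.
Qed.

(** The domain of [y] is asked to be the greatest open on which [x] is invertible, not merely a
    maximal one; this is what gives uniqueness. *)
Definition max_inverse x y : Prop :=
  exists yx : projT1 y `<=` projT1 x,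
    res F yx (projT2 x) * projT2 y = 1 /\
    forall W (Wx : W `<=` projT1 x) (w : F W),
      res F Wx (projT2 x) * w = 1 -> W `<=` projT1 y.

Lemma max_inverse_uniq x y z : max_inverse x y -> max_inverse x z -> y = z.
Proof.
move=> [yx [xy1 ymax]] [zx [xz1 zmax]].
have zy := ymax _ _ _ xz1; have yz := zmax _ _ _ xy1.
apply: (@sections_eq _ _ zy) => //.
apply: (inv_uniq _ xz1); rewrite -(rmorph1 (res F zy)) -xy1 rmorphM /= res_trans.
by congr (_ * _); exact: res_irr.
Qed.

Lemma max_inverse_exists (F_sheaf : is_sheaf F) x : exists y, max_inverse x y.
Proof.
case: F_sheaf x => F_loc F_glue [U s].
(* Indexing by opens paired with an inverse, rather than by opens alone, supplies the local inverses
   without choice and makes maximality immediate. *)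
pose I := {W : opens X & {WU : W `<=` U & {w : F W | res F WU s * w = 1}}}.
pose V (i : I) := projT1 i.
pose VU (i : I) : V i `<=` U := projT1 (projT2 i).
pose v (i : I) : F (V i) := sval (projT2 (projT2 i)).
have sv1 i : res F (VU i) s * v i = 1 := svalP (projT2 (projT2 i)).
have oD : open (\bigcup_i V i) by apply: bigcup_open => i _; exact: opens_open.
pose D := Opens oD.
have VD i : V i `<=` D by move=> p Vp; exists i.
have DU : D `<=` U by move=> p [i _ /VU].
have [|t tv] := F_glue D I V VD (fun p => id) v.
  (* On the overlap both local sections invert the restriction of [s]. *)
  move=> i j; apply: (@inv_uniq _ (res F (subset_trans (@opensIl _ _ _) (VU i)) s)).
    by rewrite -(res_trans (VU i)) -rmorphM sv1 rmorph1.
  rewrite (res_irr _ (subset_trans (@opensIr _ (V i) (V j)) (VU j))).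
  by rewrite -(res_trans (VU j)) -rmorphM sv1 rmorph1.
exists (section_of t), DU; split=> /= [|W WU w sw1].
  apply: (F_loc D I V VD) => // i.
  by rewrite rmorphM rmorph1 /= tv res_trans -(sv1 i); congr (_ * _); exact: res_irr.
exact: (VD (existT _ W (existT _ WU (exist _ w sw1)))).
Qed.

(** A product is invertible exactly where both factors are, so the greatest domain for the product
    is the intersection of the two. *)
Lemma max_inverse_mul x y x' y' : max_inverse x x' -> max_inverse y y' ->
  max_inverse (sections_mul x y) (sections_mul x' y').
Proof.
case: x y x' y' => [U s] [V t] [A s'] [B t'].
move=> [/= AU [ss' maxA]] [/= BV [tt' maxB]].
exists (setISS AU BV) => /=; split=> [|W WUV w].
  rewrite rmorphM /= !res_trans mulrACA.
  rewrite (res_irr _ (subset_trans (@opensIl _ A B) AU)).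
  rewrite (res_irr _ (subset_trans (@opensIr _ A B) BV)).
  by rewrite -(res_trans AU) -(res_trans BV) -!rmorphM ss' tt' !rmorph1 mulr1.
(* From [s * t * w = 1], [t * w] inverts [s] and [s * w] inverts [t]. *)
rewrite rmorphM /= !res_trans -mulrA => stw1; have := stw1.
rewrite mulrCA => tsw1 p Wp.
by split; [exact: maxA stw1 _ Wp | exact: maxB tsw1 _ Wp].
Qed.

Lemma max_inverse_one U : max_inverse (section_of (1 : F U)) (section_of (1 : F U)).
Proof. by exists (fun p => id); split=> //=; rewrite rmorph1 mulr1. Qed.

(** Turns the right-hand sides of M1 and M3 into units of the rings of sections. *)
Lemma sections_one_add_zero_mul x :
  sections_add (section_of (1 : F (opensT X)))
    (sections_mul (section_of (0 : F (opensT X))) x)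
  = section_of (1 : F (projT1 x)).
Proof. by case: x => U s; sections_ext; rewrite mul0r addr0. Qed.

Lemma max_inverse_mulE x y :
  max_inverse x y -> sections_mul x y = section_of (1 : F (projT1 y)).
Proof.
case: x y => [U s] [V t] [/= VU [st1 _]].
unshelve eapply sections_eq => /= [p Vp|p [_ //]|].
  by split=> //; have := VU p Vp.
rewrite rmorphM /= !res_trans res_id -st1.
by congr (_ * _); exact: res_irr.
Qed.

(** If zero is invertible over [W], then [1 = 0] in [F W], which [F_nonzero] allows only for empty
    [W]. *)
Lemma max_inverse_zero (F_nonzero : forall U, U !=set0 -> (1 : F U) <> 0) :
  max_inverse (section_of (0 : F (opensT X))) (sections_a F).
Proof.
exists (@sub0set _ _); split=> /= [|W WT w].
  (* Over the empty set zero is its own inverse, the ring there being zero. *)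
  by rewrite [LHS]sect_opens0 [RHS]sect_opens0.
rewrite rmorph0 mul0r => w1 p Wp.
by case: (F_nonzero W _ (esym w1)); exists p.
Qed.

End Sections.

Theorem theorem3p9 (X : topologicalType) (F : presheaf X)
    (F_sheaf : is_sheaf F)
    (X_nonempty : [set: X] !=set0)
    (F_nonzero : forall U : opens X, U !=set0 -> (1 : F U) <> 0) :
  exists inv : sections F -> sections F,
    is_common_meadow (sections_ops F) (sections_a F) inv.
Proof.
have [inv invP] := choice (max_inverse_exists F_sheaf).
exists inv; split=> /=.
- exact: sections_premeadow_with_a.
- by move=> x; rewrite sections_one_add_zero_mul; exact: max_inverse_mulE.
- by move=> x y; apply: max_inverse_uniq (invP _) _; exact: max_inverse_mul.
- move=> x; rewrite sections_one_add_zero_mul.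
  by apply: max_inverse_uniq (invP _) _; exact: max_inverse_one.
- by apply: max_inverse_uniq (invP _) _; exact: max_inverse_zero.
Qed.
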